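(* Let $n\ge1$ and $\mu,R>0$. (1) If $f\in\mathcal F_{\rm SmSC}^{\mu,\mu}(B_R)$, then there are $a\in\mathbb R^n$ and $b\in\mathbb R$ with $f(x)=\frac\mu2\|x-a\|_2^2+b$ for all $x\in B_R$. (2) There is an absolute constant $c_{\rm q}>0$ such that, for the whole class of functions $f_{a,b}(x)=\frac\mu2\|x-a\|_2^2+b$, $a\in\mathbb R^n$, $b\in\mathbb R$, on $B_R$, and every $\varepsilon>0$, there is a deterministic algorithm making $2n$ queries which, for every $\delta\le c_{\rm q}R\sqrt{\mu\varepsilon/n}$, every $f_{a,b}$ and every oracle $O\in\mathsf O_\delta(f_{a,b})$, returns a point $\widehat x\in B_R$ with $f_{a,b}(\widehat x)-\inf_{B_R}f_{a,b}\le\varepsilon$. (3) Hence, for query budgets $T\ge2n$, an upper bound of the form $$\Delta_{\mathcal F_{\rm SmSC}^{L,\mu}(B_R)}(\varepsilon,\beta,T)\le C\frac{\sqrt\mu\,\varepsilon}{\sqrt n\sqrt L}$$ cannot hold uniformly at $L=\mu$ in the regime $R\gg\sqrt{\varepsilon/\mu}$; that is, for every constant $C>0$ there is $K>0$ such that the bound with $L=\mu$ fails for all $n\ge1$, $\mu,\varepsilon>0$, $0<\beta<1/2$, $T\ge2n$ and $R\ge K\sqrt{\varepsilon/\mu}$.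
   Context: $B_R=\{x\in\mathbb R^n:\|x\|_2\le R\}$. $\mathcal F_{\rm SmSC}^{L,\mu}(B_R)$ is the class of convex functions $f:B_R\to\mathbb R$ that are $L$-smooth on $B_R$ ($f$ is continuously differentiable on a neighbourhood of $B_R$ and $\nabla f$ is $L$-Lipschitz on $B_R$) and $\mu$-strongly convex, i.e. $f(y)\ge f(x)+\langle s_x,y-x\rangle+\frac\mu2\|y-x\|_2^2$ for $x,y\in B_R$, $s_x\in\partial f(x)$. Noisy oracle: for $f:S\to\mathbb R$, $S\subset\mathbb R^n$, $\delta\ge0$, let $\mathsf O_\delta(f)=\{O:S\to\mathbb R:\ \sup_{x\in S}|O(x)-f(x)|\le\delta\}$. In this result $S=B_R$. Solvability: algorithms query points of $S$ and output a point of $S$. A randomized adaptive algorithm $A$ making at most $T$ oracle calls $(\varepsilon,\beta,\delta,T)$-solves a class $\mathcal F$ of functions on $S$ if for every $f\in\mathcal F$ and every deterministic oracle $O\in\mathsf O_\delta(f)$ its output $A^O$ satisfies $\mathbb P_A\{f(A^O)-\inf_S f\le\varepsilon\}\ge1-\beta$, the probability being over the internal randomness of $A$ (deterministic adaptive algorithms are included). The maximum admissible level of noise is $\Delta_{\mathcal F}(\varepsilon,\beta,T)=\sup\{\delta:\ \text{there is }A\text{ that }(\varepsilon,\beta,\delta,T)\text{-solves }\mathcal F\}$. *)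

(* Defs.v *)
From HB Require Import structures.
From mathcomp Require Import all_boot all_order all_algebra.
From mathcomp Require Import all_classical all_reals all_analysis.

Set Implicit Arguments.
Unset Strict Implicit.
Unset Printing Implicit Defensive.
Import Order.TTheory GRing.Theory Num.Theory.
Import numFieldNormedType.Exports.

Local Open Scope classical_set_scope.
Local Open Scope ring_scope.

(* The library norm on ['rV[R]_n] is the sup norm: it is used below only through
   the topology and differentiability, which do not depend on the choice of a
   norm; every metric quantity uses [l2norm]. *)
Definition dot (R : realType) (n : nat) (u v : 'rV[R]_n) : R :=
  \sum_(i < n) u ord0 i * v ord0 i.

Definition l2norm (R : realType) (n : nat) (x : 'rV[R]_n) : R :=
  Num.sqrt (dot x x).

Definition l2ball (R : realType) (n : nat) (r : R) : set 'rV[R]_n :=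
  [set x | l2norm x <= r].
Arguments l2ball {R n} r.

Definition grad (R : realType) (n : nat) (g : 'rV[R]_n -> R) (x : 'rV[R]_n) :
    'rV[R]_n :=
  \row_(i < n) 'D_(delta_mx ord0 i) g x.

(* A function on a subset [S] is represented by a total function whose values
   outside [S] are irrelevant: subgradients only test points of [S], and the
   smooth extension [g] to a neighbourhood of [S] is quantified explicitly. *)
Definition subdifferential (R : realType) (n : nat) (S : set 'rV[R]_n)
    (f : 'rV[R]_n -> R) (x : 'rV[R]_n) : set 'rV[R]_n :=
  [set s | forall y, S y -> f x + dot s (y - x) <= f y].

Definition smooth_on (R : realType) (n : nat) (L : R) (S : set 'rV[R]_n)
    (f : 'rV[R]_n -> R) : Prop :=
  exists (g : 'rV[R]_n -> R) (U : set 'rV[R]_n),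
    [/\ open U, S `<=` U, (forall x, S x -> g x = f x),
        (forall x, U x -> differentiable g x /\ {for x, continuous (grad g)}) &
        (forall x y, S x -> S y -> l2norm (grad g x - grad g y) <= L * l2norm (x - y))].

Definition strongly_convex_on (R : realType) (n : nat) (mu : R)
    (S : set 'rV[R]_n) (f : 'rV[R]_n -> R) : Prop :=
  forall x y s, S x -> S y -> subdifferential S f x s ->
    f x + dot s (y - x) + mu / 2 * l2norm (y - x) ^+ 2 <= f y.

Definition SmSC (R : realType) (n : nat) (L mu : R) (S : set 'rV[R]_n) :
    set ('rV[R]_n -> R) :=
  [set f | [/\ convex_function S f, smooth_on L S f & strongly_convex_on mu S f]].

Definition quad (R : realType) (n : nat) (mu : R) (a : 'rV[R]_n) (b : R)
    (x : 'rV[R]_n) : R :=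
  mu / 2 * l2norm (x - a) ^+ 2 + b.

(* Oracles are total functions as well; algorithms on [S] never query them
   outside [S]. *)
Definition noisy_oracle (R : realType) (X : Type) (S : set X) (delta : R)
    (f : X -> R) : set (X -> R) :=
  [set O | forall x, S x -> `|O x - f x| <= delta].

(* Deterministic adaptive algorithms are decision trees: the next query, or the
   decision to stop and output a point, depends on all previous answers. *)
Inductive algorithm (X Y : Type) : Type :=
| Output of X
| Query of X & (Y -> algorithm X Y).

Fixpoint queries (X Y : Type) (O : X -> Y) (A : algorithm X Y) : seq X :=
  match A with
  | Output _ => [::]
  | Query x k => x :: queries O (k (O x))
  end.

Fixpoint output (X Y : Type) (O : X -> Y) (A : algorithm X Y) : X :=
  match A with
  | Output x => x
  | Query x k => output O (k (O x))
  end.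

Definition algorithm_on (X : eqType) (Y : Type) (S : set X)
    (A : algorithm X Y) : Prop :=
  forall O : X -> Y,
    (forall x, x \in queries O A -> S x) /\ S (output O A).

(* Extended-real infimum, so that the gap is [+oo] when [f] is unbounded below. *)
Definition opt_gap (R : realType) (X : Type) (S : set X) (f : X -> R) (x : X) :
    \bar R :=
  ((f x)%:E - ereal_inf [set (f y)%:E | y in S])%E.

(* A randomized algorithm is a random deterministic one.  The answers of an
   arbitrary oracle need not depend measurably on the queries, so measurability
   of the success event is part of the claim about its probability. *)
Definition solves (R : realType) (X : eqType) (S : set X) (F : set (X -> R))
    (eps beta delta : R) (T : nat) (d : measure_display)
    (Omega : measurableType d) (P : probability Omega R)
    (A : Omega -> algorithm X R) : Prop :=
  (forall w, algorithm_on S (A w) /\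
     forall O : X -> R, (size (queries O (A w)) <= T)%N) /\
  (forall f O, F f -> noisy_oracle S delta f O ->
     let success := [set w | (opt_gap S f (output O (A w)) <= eps%:E)%E] in
     measurable success /\ ((1 - beta)%:E <= P success)%E).

Definition max_noise (R : realType) (X : eqType) (S : set X) (F : set (X -> R))
    (eps beta : R) (T : nat) : \bar R :=
  ereal_sup [set delta%:E | delta in
    [set delta : R | 0 <= delta /\
      exists (d : measure_display) (Omega : measurableType d)
             (P : probability Omega R) (A : Omega -> algorithm X R),
        solves S F eps beta delta T P A]].

(* Main.v *)
Require Import Defs.
From HB Require Import structures.
From mathcomp Require Import all_boot all_order all_algebra.
From mathcomp Require Import all_classical all_reals all_analysis.
From mathcomp Require Import ring lra.
Import Order.TTheory GRing.Theory Num.Theory.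
Import numFieldNormedType.Exports.

Local Open Scope classical_set_scope.
Local Open Scope ring_scope.

(** For [L = mu] strong monotonicity and the Lipschitz bound force
    [grad f x - mu x] to be constant, so [f] is a quadratic [quad mu a b].  For a
    quadratic, [f (- r e_i) - f (r e_i) = 2 mu r a_i]: central differences over the
    whole diameter of the ball recover [a] with error [delta / (mu r)] per
    coordinate, and projecting the estimate on the ball loses at most
    [mu / 2 * n * (delta / (mu r)) ^ 2].  The tolerated noise
    [r * sqrt (mu * eps / n)] exceeds [C * eps / sqrt n] once
    [r >= (C + 1) * sqrt (eps / mu)]. *)

(** * Euclidean geometry: inner product, the ball and its projection, quadratics *)

Section EuclideanSpace.
Context {R : realType} {n : nat}.
Implicit Types (u v w x y : 'rV[R]_n) (c r : R).

Lemma dotC u v : dot u v = dot v u.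
Proof. by apply: eq_bigr => i _; rewrite mulrC. Qed.

Lemma dotDl u v w : dot (u + v) w = dot u w + dot v w.
Proof. by rewrite -big_split; apply: eq_bigr => i _; rewrite mxE mulrDl. Qed.

Lemma dotZl c u v : dot (c *: u) v = c * dot u v.
Proof. by rewrite mulr_sumr; apply: eq_bigr => i _; rewrite mxE mulrA. Qed.

Lemma dotNl u v : dot (- u) v = - dot u v.
Proof. by rewrite -scaleN1r dotZl mulN1r. Qed.

Lemma dotDr u v w : dot u (v + w) = dot u v + dot u w.
Proof. by rewrite dotC dotDl !(dotC u). Qed.

Lemma dotZr c u v : dot u (c *: v) = c * dot u v.
Proof. by rewrite dotC dotZl dotC. Qed.

Lemma dotNr u v : dot u (- v) = - dot u v.
Proof. by rewrite dotC dotNl dotC. Qed.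

Definition dotE := (dotDl, dotDr, dotNl, dotNr, dotZl, dotZr).

Lemma dot_delta_mx (i : 'I_n) u : dot (delta_mx ord0 i) u = u ord0 i.
Proof.
rewrite /dot (bigD1 i) //= big1 ?addr0; first by rewrite mxE !eqxx mul1r.
by move=> j /negPf ji; rewrite mxE eqxx ji mul0r.
Qed.

Lemma dot_ge0 u : 0 <= dot u u.
Proof. by apply: sumr_ge0 => i _; rewrite -expr2 sqr_ge0. Qed.

Lemma dot_eq0 u : dot u u = 0 -> u = 0.
Proof.
move=> u0; apply/rowP => i; rewrite mxE; apply/eqP; rewrite -[_ == _]orbb -mulf_eq0.
apply/eqP; apply: (psumr_eq0P _ u0) => // j _; rewrite -expr2; exact: sqr_ge0.
Qed.

Lemma sqr_l2norm u : l2norm u ^+ 2 = dot u u.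
Proof. by rewrite sqr_sqrtr ?dot_ge0. Qed.

Lemma l2ballP r u : 0 <= r -> l2ball r u <-> dot u u <= r ^+ 2.
Proof.
move=> r0; rewrite -sqr_l2norm /l2ball /=.
by rewrite ler_sqr ?nnegrE ?sqrtr_ge0.
Qed.

(** Rests on [|t x + (1 - t) y|^2 = t |x|^2 + (1 - t) |y|^2 - t (1 - t) |x - y|^2]. *)
Lemma l2ball_convex r : 0 <= r -> convex_set (l2ball r : set 'rV[R]_n).
Proof.
move=> r0 x y t /set_mem /(l2ballP r x r0) xr /set_mem /(l2ballP r y r0) yr.
apply/mem_set/l2ballP => //; rewrite /conv/= !dotE (dotC y x).
have := dot_ge0 (x - y); rewrite !dotE (dotC y x) /unstable.onem => xy.
have t0 : 0 <= t%:num by [].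
have t1 : 0 <= 1 - t%:num by rewrite subr_ge0.
move: xr yr; rewrite -subr_ge0 => /(mulr_ge0 t0) xr.
rewrite -subr_ge0 => /(mulr_ge0 t1) yr.
have := mulr_ge0 (mulr_ge0 t0 t1) xy.
lra.
Qed.

Definition l2proj r u : 'rV[R]_n :=
  if l2norm u <= r then u else (r / l2norm u) *: u.

Lemma l2proj_in r u : 0 <= r -> l2ball r (l2proj r u).
Proof.
rewrite /l2proj; case: ifPn => // /negP ur r0; apply/l2ballP => //.
have N0 : 0 < l2norm u by lra.
by rewrite !dotE -sqr_l2norm mulrA -!expr2 -exprMn divfK ?gt_eqF.
Qed.

(** Outside the ball, [u - p] is a nonnegative multiple of the projection [p], with [|p| = r].
    Expanding [|p - y|^2 >= 0] gives [<p, y> <= r^2 = <p, p>]. *)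
Lemma l2proj_obtuse r u y :
  0 <= r -> l2ball r y -> dot (u - l2proj r u) (y - l2proj r u) <= 0.
Proof.
move=> r0 /(l2ballP _ _ r0) yr.
have [ur|ur] := boolP (l2norm u <= r); first by rewrite /l2proj ur !dotE; lra.
have N0 : 0 < l2norm u by move/negP: ur; lra.
rewrite /l2proj ifN //; move: ur; rewrite -ltNge => ur.
set p := _ *: u.
have pp : dot p p = r ^+ 2.
  by rewrite /p !dotE -sqr_l2norm mulrA -!expr2 -exprMn divfK ?gt_eqF.
(* The multiple [|u| / r - 1] used below divides by [r]; at [r = 0] the ball is a single point and
   [y - p] vanishes. *)
have [r_eq0|r_neq0] := eqVneq r 0.
  have -> : p = 0 by rewrite /p r_eq0 mul0r scale0r.
  have -> : y = 0.
    apply: dot_eq0; have := dot_ge0 y; move: yr; rewrite r_eq0 expr0n /=; lra.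
  by rewrite !subr0 -[X in dot _ X](scale0r u) dotZr mul0r.
have rgt0 : 0 < r by rewrite lt_neqAle eq_sym r_neq0.
have -> : u - p = (l2norm u / r - 1) *: p.
  rewrite scalerBl scale1r /p scalerA; congr (_ - _).
  rewrite mulrA divfK // divff ?gt_eqF // scale1r //.
rewrite dotZl mulr_ge0_le0 //; first by rewrite subr_ge0 ler_pdivlMr // mul1r ltW.
clearbody p; have := dot_ge0 (p - y); rewrite !dotE (dotC y p) pp; lra.
Qed.

(* Projecting an estimate [v] of [a] costs only a term quadratic in the error,
   even when [a] is far outside the ball: the linear term [2 <p - y, v - a>] is
   absorbed by [-|p - y|^2], which the obtuse angle at the projection provides. *)
Lemma l2proj_gap r v a y : 0 <= r -> l2ball r y ->
  dot (l2proj r v - a) (l2proj r v - a) <=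
  dot (y - a) (y - a) + dot (v - a) (v - a).
Proof.
move=> r0 yr; have := l2proj_obtuse r v y r0 yr; set p := l2proj r v.
have := dot_ge0 (p - y - (v - a)).
rewrite !dotE (dotC y v) (dotC y p) (dotC y a) (dotC v p) (dotC v a) (dotC a p).
lra.
Qed.

Lemma quadE mu a b x : quad mu a b x = mu / 2 * dot (x - a) (x - a) + b.
Proof. by rewrite /quad sqr_l2norm. Qed.

Lemma quad_oppr mu a b x :
  quad mu a b (- x) - quad mu a b x = 2 * mu * dot x a.
Proof. by rewrite !quadE !dotE (dotC a x); lra. Qed.

End EuclideanSpace.

(** * Gradients of convex functions and rigidity of the class at [L = mu] *)

Section Gradient.
Context {R : realType} {n : nat}.
Implicit Types (S : set 'rV[R]_n) (f g : 'rV[R]_n -> R) (x y v : 'rV[R]_n).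

Lemma derive_grad g x v : differentiable g x -> 'D_v g x = dot (grad g x) v.
Proof.
move=> dg; rewrite deriveE // {1}(row_sum_delta v) linear_sum.
by apply: eq_bigr => i _; rewrite linearZ /= -deriveE // mxE mulrC.
Qed.

(** By convexity the difference quotients along the segment from [x] to [y] are at most [f y - f x],
    and the bound passes to the limit. The limit is one-sided because only steps [0 < h <= 1] stay
    on the segment, where [g] agrees with [f]. *)
Lemma grad_subdifferential S f g x : convex_set S -> convex_function S f ->
  (forall y, S y -> g y = f y) -> differentiable g x -> S x ->
  subdifferential S f x (grad g x).
Proof.
move=> cS cf gf dg Sx y Sy /=; rewrite -lerBrDl -derive_grad //.
have := @diff_derivable _ _ _ g x (y - x) dg.
move=> /cvg_dnbhs_at_right /cvgr_to_le; apply.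
near=> h.
have h0 : 0 < h by near: h; exact: nbhs_right_gt.
have h1 : h <= 1 by near: h; exact: nbhs_right_le.
have := cf (Itv01 (ltW h0) h1) y x (mem_set Sy) (mem_set Sx).
have := set_mem (cS y x (Itv01 (ltW h0) h1) (mem_set Sy) (mem_set Sx)).
rewrite /conv /= /unstable.onem.
have -> : h *: y + (1 - h) *: x = h *: (y - x) + x.
  by rewrite scalerBr scalerBl scale1r addrAC addrA.
move=> Sz; rewrite -!gf // => le_conv.
have {}le_conv : g (h *: (y - x) + x) <= h * g y + (1 - h) * g x := le_conv.
rewrite ler_pdivrMl //=; lra.
Unshelve. all: by end_near.
Qed.

(* The two moduli pinch the gradient: [G x - G y] and [mu (x - y)] have a
   difference of squared norm at most [mu^2 - 2 mu^2 + mu^2 = 0]. *)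
Lemma grad_affine S mu f g x y : 0 <= mu ->
  convex_set S -> convex_function S f -> strongly_convex_on mu S f ->
  (forall z, S z -> g z = f z) -> (forall z, S z -> differentiable g z) ->
  (forall u v, S u -> S v ->
    l2norm (grad g u - grad g v) <= mu * l2norm (u - v)) ->
  S x -> S y -> grad g x - mu *: x = grad g y - mu *: y.
Proof.
move=> mu0 cS cf scf gf dg lipg Sx Sy.
have sub z : S z -> subdifferential S f z (grad g z).
  by move=> Sz; apply: grad_subdifferential => //; exact: dg.
have := scf _ _ _ Sx Sy (sub _ Sx); have := scf _ _ _ Sy Sx (sub _ Sy).
have : l2norm (grad g x - grad g y) ^+ 2 <= (mu * l2norm (x - y)) ^+ 2.
  rewrite ler_sqr ?nnegrE ?mulr_ge0 ?sqrtr_ge0 //; exact: lipg.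
rewrite exprMn !sqr_l2norm; set p := grad g x; set q := grad g y.
move=> lip scy scx; apply/eqP; rewrite -subr_eq0; apply/eqP/dot_eq0.
apply/eqP; rewrite eq_le dot_ge0 andbT.
(* Adding the two strong convexity inequalities gives strong monotonicity. The extra factor [mu]
   matches the cross term of the expanded square, so that [lra] can finish linearly. *)
have mono : 0 <= mu * (dot (p - q) (x - y) - mu * dot (x - y) (x - y)).
  apply: mulr_ge0 => //; move: scx scy; rewrite !dotE (dotC y x).
  lra.
move: lip mono; rewrite !dotE (dotC q p) (dotC y x) (dotC y p) (dotC y q).
rewrite (dotC x p) (dotC x q); lra.
Qed.

Lemma SmSC_diag_quad S mu f : 0 < mu -> convex_set S ->
  SmSC mu mu S f -> exists a b, forall x, S x -> f x = quad mu a b x.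
Proof.
move=> mu0 cS [cf [g [U [_ SU gf dg lipg]]] scf].
have [[x0 Sx0]|S0] := pselect (exists x, S x); last first.
  by exists 0, 0 => x Sx; case: S0; exists x.
have dgS z : S z -> differentiable g z by move=> /SU /dg [].
(* The zero of the affine map that [grad g] follows on [S]; it may lie outside [S]. *)
pose a := x0 - mu^-1 *: grad g x0.
have gradE x : S x -> grad g x = mu *: (x - a).
  move=> Sx; have := grad_affine S mu f g x x0 (ltW mu0) cS cf scf gf dgS lipg Sx Sx0.
  move/eqP; rewrite subr_eq => /eqP ->.
  by rewrite /a !scalerBr scalerA divff ?gt_eqF // scale1r opprB addrC.
(* With gradient [mu (x - a)], the lower bound on [f y - f x] from strong convexity is exactly
   [mu / 2 * (|y - a|^2 - |x - a|^2)]. Exchanging [x] and [y] then makes [f] minus the quadratic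
   constant, without integration. *)
clearbody a; have gap x y : S x -> S y ->
    f x - mu / 2 * dot (x - a) (x - a) <= f y - mu / 2 * dot (y - a) (y - a).
  move=> Sx Sy.
  have := scf _ _ _ Sx Sy
    (grad_subdifferential _ _ _ _ cS cf gf (dgS _ Sx) Sx).
  rewrite sqr_l2norm gradE // !dotE (dotC y x) (dotC a x) (dotC a y); lra.
exists a, (f x0 - mu / 2 * dot (x0 - a) (x0 - a)) => x Sx.
rewrite quadE; have := gap _ _ Sx Sx0; have := gap _ _ Sx0 Sx; lra.
Qed.
End Gradient.

(** * The central difference algorithm and its error analysis *)

Section Algorithm.

(** A degenerate decision tree: the queries are fixed in advance, and [k] receives all answers in
    query order. *)
Fixpoint nonadaptive (X Y : Type) (s : seq X) (k : seq Y -> X) :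
    algorithm X Y :=
  match s with
  | [::] => Output Y (k [::])
  | x :: s' => Query x (fun y => nonadaptive X Y s' (fun ys => k (y :: ys)))
  end.

Lemma queries_nonadaptive (X Y : Type) (O : X -> Y) s k :
  queries O (nonadaptive X Y s k) = s.
Proof. by elim: s k => //= x s IH k; rewrite IH. Qed.

Lemma output_nonadaptive (X Y : Type) (O : X -> Y) s k :
  output O (nonadaptive X Y s k) = k (map O s).
Proof. by elim: s k => //= x s IH k; rewrite IH. Qed.

Context {R : realType} {n : nat}.
Implicit Types (mu r eps : R) (a : 'rV[R]_n).

Definition axis_points r : seq 'rV[R]_n :=
  [seq r *: delta_mx ord0 i | i <- enum 'I_n] ++
  [seq - (r *: delta_mx ord0 i) | i <- enum 'I_n].

(** In the order of [axis_points], answer [n + i] belongs to the antipode of point [i]. The divisor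
    is the coefficient of [a_i] in [quad_oppr] at [r e_i]. *)
Definition difference_estimate mu r (ys : seq R) : 'rV[R]_n :=
  \row_i ((ys`_(n + i) - ys`_i) / (2 * mu * r)).

Definition quad_solver mu r : algorithm 'rV[R]_n R :=
  nonadaptive _ _ (axis_points r)
    (fun ys => l2proj r (difference_estimate mu r ys)).

Lemma difference_estimateE mu r (O : 'rV[R]_n -> R) :
  difference_estimate mu r (map O (axis_points r)) =
  \row_i ((O (- (r *: delta_mx ord0 i)) - O (r *: delta_mx ord0 i)) /
          (2 * mu * r)).
Proof.
apply/rowP => i; rewrite !mxE /axis_points map_cat.
have sz (f : 'I_n -> 'rV[R]_n) : size (map O (map f (enum 'I_n))) = n.
  by rewrite 2!size_map size_enum_ord.
have nthE (f : 'I_n -> 'rV[R]_n) : (map O (map f (enum 'I_n)))`_i = O (f i).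
  have ltin : (i < size (enum 'I_n))%N by rewrite size_enum_ord.
  rewrite (nth_map (0 : 'rV[R]_n)); last by rewrite size_map.
  by rewrite (nth_map i) // nth_ord_enum.
by rewrite !nth_cat !sz ltn_ord ltnNge leq_addr /= addKn !nthE.
Qed.

Lemma axis_point_in r (i : 'I_n) : 0 <= r ->
  l2ball r (r *: delta_mx ord0 i : 'rV[R]_n) /\
  l2ball r (- (r *: delta_mx ord0 i) : 'rV[R]_n).
Proof.
move=> r0; split; apply/l2ballP => //;
  by rewrite !dotE dot_delta_mx mxE !eqxx /= ?mulr1 ?mulrN ?opprK -expr2.
Qed.

Lemma quad_solver_on mu r : 0 <= r -> algorithm_on (l2ball r) (quad_solver mu r).
Proof.
move=> r0 O; rewrite queries_nonadaptive output_nonadaptive; split.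
  by move=> x; rewrite mem_cat => /orP[] /mapP[i _ ->];
    case: (axis_point_in r i r0).
exact: l2proj_in.
Qed.

Lemma size_queries_quad_solver mu r (O : 'rV[R]_n -> R) :
  size (queries O (quad_solver mu r)) = (2 * n)%N.
Proof.
rewrite queries_nonadaptive size_cat mul2n -addnn.
by congr addn; rewrite size_map size_enum_ord.
Qed.

Lemma difference_estimate_error mu r delta a b (O : 'rV[R]_n -> R) :
  0 < mu -> 0 < r -> noisy_oracle (l2ball r) delta (quad mu a b) O ->
  let e := difference_estimate mu r (map O (axis_points r)) - a in
  dot e e <= n%:R * (delta / (mu * r)) ^+ 2.
Proof.
move=> mu0 r0 On /=; rewrite difference_estimateE [n%:R * _]mulr_natl.
set c := (delta / (mu * r)) ^+ 2.
have -> : c *+ n = \sum_(i < n) c by rewrite sumr_const card_ord.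
rewrite {}/c; apply: ler_sum => i _.
(* Square roots reduce the termwise bound to absolute values. *)
rewrite -expr2 -ler_sqrt ?sqr_ge0 // !sqrtr_sqr.
have [/On Op /On Om] := axis_point_in r i (ltW r0).
have mr0 : 0 < mu * r by rewrite mulr_gt0.
have := quad_oppr mu a b (r *: delta_mx ord0 i).
rewrite dotZl dot_delta_mx !mxE => qE.
set p := O (- _) in Om *; set q := O _ in Op *.
have -> : (p - q) / (2 * mu * r) - a ord0 i =
          (p - q - 2 * mu * (r * a ord0 i)) / (2 * (mu * r)).
  by field; rewrite !gt_eqF.
rewrite normrM normfV (gtr0_norm (_ : 0 < 2 * (mu * r))); last by lra.
rewrite ler_pdivrMr; last by lra.
(* The sign of [delta] comes from the noise bound at a queried point. *)
have -> : `|delta / (mu * r)| = delta / (mu * r).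
  rewrite ger0_norm ?divr_ge0 ?(ltW mr0) //.
  exact: le_trans (normr_ge0 _) Op.
have -> : delta / (mu * r) * (2 * (mu * r)) = 2 * delta.
  by field; rewrite !gt_eqF.
rewrite -qE.
move: Op Om; rewrite !ler_norml => /andP[? ?] /andP[? ?]; apply/andP; split; lra.
Qed.

(** The value [f x - eps] is a lower bound on [S], hence below the extended infimum, whether or not
    that infimum is attained. *)
Lemma opt_gap_le (X : Type) (S : set X) (f : X -> R) x eps :
  (forall y, S y -> f x <= f y + eps) -> (opt_gap S f x <= eps%:E)%E.
Proof.
move=> fx; apply: (@le_trans _ _ ((f x)%:E - (f x - eps)%:E)%E).
  apply: leeB => //; apply: le_ereal_inf_tmp => _ [y Sy <-].
  by rewrite lee_fin lerBlDr fx.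
by rewrite -EFinB lee_fin; lra.
Qed.

Lemma quad_solver_correct mu r eps delta a b (O : 'rV[R]_n -> R) :
  0 < mu -> 0 < r -> 0 < eps -> (0 < n)%N -> 0 <= delta ->
  delta <= r * Num.sqrt (mu * eps / n%:R) ->
  noisy_oracle (l2ball r) delta (quad mu a b) O ->
  forall y, l2ball r y ->
    quad mu a b (output O (quad_solver mu r)) <= quad mu a b y + eps.
Proof.
move=> mu0 r0 eps0 n0 d0 d_le On y yr; rewrite output_nonadaptive !quadE.
have := difference_estimate_error mu r delta a b O mu0 r0 On.
set v := difference_estimate _ _ _ => /= err.
have := l2proj_gap r v a y (ltW r0) yr.
have n0' : 0 < n%:R :> R by rewrite ltr0n.
(* After multiplication by [mu / 2] this costs only [eps / 2], so the noise constant 1 leaves a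
   factor of two to spare. *)
suff : n%:R * (delta / (mu * r)) ^+ 2 <= eps / mu.
  move=> e1 e2; have {}e2 := le_trans e2 (lerD (lexx _) (le_trans err e1)).
  have : mu * (dot (y - a) (y - a) + eps / mu) = mu * dot (y - a) (y - a) + eps.
    by field; rewrite gt_eqF.
  move: e2; rewrite -(ler_pM2l mu0) => e2 e3; move: e2; rewrite e3; lra.
have : delta ^+ 2 <= r ^+ 2 * (mu * eps / n%:R).
  rewrite -[X in _ * X]sqr_sqrtr; last by rewrite !mulr_ge0 ?invr_ge0 ?ltW.
  by rewrite -exprMn ler_sqr ?nnegrE // mulr_ge0 ?sqrtr_ge0 // ltW.
move=> d_le2; rewrite expr_div_n mulrA ler_pdivrMr ?exprn_gt0 ?mulr_gt0 //.
have -> : eps / mu * (mu * r) ^+ 2 = n%:R * (r ^+ 2 * (mu * eps / n%:R)).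
  by field; rewrite !gt_eqF.
by rewrite ler_pM2l.
Qed.
End Algorithm.

(** * From deterministic to randomized solvability, and the theorem *)

Lemma deterministic_solves (R : realType) (X : eqType) (S : set X)
    (F : set (X -> R)) (eps beta delta : R) (T : nat) (A : algorithm X R) :
  0 <= beta -> algorithm_on S A ->
  (forall O, size (queries O A) <= T)%N ->
  (forall f O, F f -> noisy_oracle S delta f O ->
     (opt_gap S f (output O A) <= eps%:E)%E) ->
  solves S F eps beta delta T (dirac tt : probability unit R) (fun=> A).
Proof.
move=> beta0 AS AT AF; split => // f O Ff On /=.
(* On the one-point space the success event is everything, which settles both its measurability and
   its probability. *)
have -> : [set w : unit | (opt_gap S f (output O A) <= eps%:E)%E] = setT.
  by apply/seteqP; split => // w _; exact: AF.
by rewrite probability_setT lee_fin; split => //; lra.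
Qed.

Theorem mainTheorem5 (R : realType) :
  [/\ (forall (n : nat) (mu r : R), (1 <= n)%N -> 0 < mu -> 0 < r ->
        forall f : 'rV[R]_n -> R, SmSC mu mu (l2ball r) f ->
        exists (a : 'rV[R]_n) (b : R),
          forall x, l2ball r x -> f x = mu / 2 * l2norm (x - a) ^+ 2 + b),
      (exists cq : R, 0 < cq /\
        forall (n : nat) (mu r eps : R),
          (1 <= n)%N -> 0 < mu -> 0 < r -> 0 < eps ->
        exists A : algorithm 'rV[R]_n R,
          [/\ algorithm_on (l2ball r) A,
              (forall O : 'rV[R]_n -> R, size (queries O A) = (2 * n)%N) &
              (forall (delta : R) (a : 'rV[R]_n) (b : R) (O : 'rV[R]_n -> R),
                 0 <= delta -> delta <= cq * r * Num.sqrt (mu * eps / n%:R) ->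
                 noisy_oracle (l2ball r) delta (quad mu a b) O ->
                 l2ball r (output O A) /\
                 (opt_gap (l2ball r) (quad mu a b) (output O A) <= eps%:E)%E)]) &
      (forall C : R, 0 < C ->
        exists K : R, 0 < K /\
        forall (n : nat) (mu eps beta r : R) (T : nat),
          (1 <= n)%N -> 0 < mu -> 0 < eps -> 0 < beta -> beta < 1 / 2 ->
          (2 * n <= T)%N -> K * Num.sqrt (eps / mu) <= r ->
          let L := mu in
          ~ (max_noise (l2ball r) (SmSC L mu (l2ball r) : set ('rV[R]_n -> R))
               eps beta T
             <= (C * (Num.sqrt mu * eps / (Num.sqrt n%:R * Num.sqrt L)))%:E)%E)].
Proof.
have SmSCq n mu r f : 0 < mu -> 0 < r -> SmSC mu mu (l2ball r) f ->
    exists a b, forall x : 'rV[R]_n, l2ball r x -> f x = quad mu a b x.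
  move=> mu0 r0; apply: SmSC_diag_quad => //; exact/l2ball_convex/ltW.
split.
- by move=> n mu r _ mu0 r0 f; exact: SmSCq.
- exists 1; split => // n mu r eps n1 mu0 r0 eps0; exists (quad_solver mu r).
  split; [exact/quad_solver_on/ltW | exact: size_queries_quad_solver |].
  move=> delta a b O d0; rewrite mul1r => d_le On; split.
    by have [] := @quad_solver_on R n mu r (ltW r0) O.
  by apply: opt_gap_le; exact: quad_solver_correct On.
(* The [+ 1] makes the comparison with [delta] below strict. *)
- move=> C C0; exists (C + 1); split; first by lra.
  move=> n mu eps beta r T n1 mu0 eps0 beta0 _ Tn Kr L.
  have em0 : 0 < Num.sqrt (eps / mu) by rewrite sqrtr_gt0 divr_gt0.
  have r0 : 0 < r by apply: lt_le_trans Kr; rewrite mulr_gt0 //; lra.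
  have n0 : 0 < n%:R :> R by rewrite ltr0n.
  pose delta := r * Num.sqrt (mu * eps / n%:R).
  have d0 : 0 <= delta by rewrite mulr_ge0 ?sqrtr_ge0 ?ltW.
  apply/negP; rewrite -ltNge.
  (* The claimed bound is strictly below [delta], and [delta] is an admissible noise level, hence at
     most the supremum. *)
  apply: (@lt_le_trans _ _ delta%:E).
    rewrite lte_fin /delta /L.
    (* Everything is expressed through [sqrt (eps / mu)], the quantity that the hypothesis on [r]
       controls; the common factor [1 / sqrt n] then cancels. *)
    have -> : Num.sqrt (mu * eps / n%:R) =
              mu * Num.sqrt (eps / mu) / Num.sqrt n%:R.
      have -> : mu * eps / n%:R = mu ^+ 2 * (eps / mu) / n%:R.
        by field; rewrite !gt_eqF.
      rewrite sqrtrM; last by rewrite mulr_ge0 ?sqr_ge0 // divr_ge0 ?ltW.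
      by rewrite sqrtrM ?sqr_ge0 // sqrtr_sqr gtr0_norm // sqrtrV // ltW.
    have sn : 0 < Num.sqrt n%:R :> R by rewrite sqrtr_gt0.
    have sm : 0 < Num.sqrt mu by rewrite sqrtr_gt0.
    have -> : C * (Num.sqrt mu * eps / (Num.sqrt n%:R * Num.sqrt mu)) =
              C * eps / Num.sqrt n%:R.
      by field; rewrite !gt_eqF.
    rewrite mulrA ltr_pM2r ?invr_gt0 //.
    have epsE : eps = mu * Num.sqrt (eps / mu) ^+ 2.
      by rewrite sqr_sqrtr ?divr_ge0 ?ltW //; field; rewrite gt_eqF.
    rewrite {1}epsE; have msd := mulr_gt0 mu0 em0.
    have := ler_wpM2r (ltW msd) Kr; have := mulr_gt0 msd em0.
    rewrite expr2; lra.
  apply: ereal_sup_ubound; exists delta => //; split => //.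
  exists _, unit, (dirac tt), (fun=> quad_solver mu r).
  apply: deterministic_solves; [exact: ltW | exact/quad_solver_on/ltW | |].
    by move=> O; rewrite size_queries_quad_solver.
  (* The function [f] equals a quadratic only on the ball, so the output and the oracle's noise
     bound are transferred at points of the ball. *)
  move=> f O /(SmSCq _ _ _ _ mu0 r0) [a [b fq]] On; apply: opt_gap_le => y yr.
  rewrite !fq //; last by have [] := @quad_solver_on R n mu r (ltW r0) O.
  apply: (quad_solver_correct mu r eps delta) => // x xr.
  by rewrite -fq //; exact: On.
Qed.
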